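(* Let $K$ be an oriented, non-split alternating link in $S^3$, and let $P_K$ be the polynomial invariant defined in the context. If $K$ is invertible, i.e. $K=-K$ (up to isotopy, where $-K$ is $K$ with the orientations of all components reversed), then $$P_K(x,y,z,w)=P_K(y,x,w,z).$$ If $K$ is amphichiral, i.e. $K=m(K)$ (up to isotopy, where $m(K)$ is $K$ with all crossings switched), then $$P_K(x,y,z,w)=P_K(z^{-1},w^{-1},x^{-1},y^{-1}).$$
   Context: All links are oriented and non-split. A link is alternating if it has a diagram in which each component alternates between over- and undercrossings (an alternating diagram). Crossing signs: rotate the picture so both strands point upward; the crossing is positive if the overstrand runs from lower left to upper right, negative if it runs from lower right to upper left. Tait digraph. Let $D\subset\mathbb{R}^2$ be an alternating diagram of a non-split link. Regions of $D$ are the components of the complement of the underlying 4-valent plane graph. Choose the checkerboard shading of the regions such that at every crossing, when the picture is rotated so that the overstrand runs from lower left to upper right, the top and bottom regions are the shaded ones. The Tait digraph $G=(V,E)$ is the plane digraph with one vertex in each shaded region and one edge through each crossing, joining the vertices of the two shaded regions at that crossing (loops and multiple edges allowed), directed to match the overcrossing: rotating so that the overstrand is directed from lower left to upper right, the edge points from the bottom region to the top region. An edge is positive or negative according to the sign of its crossing; $E=E_+\sqcup E_-$. Activities. Fix a root vertex $r\in V$ and a basepoint $q\in\mathbb{R}^2\setminus G$. Let $T$ be a spanning tree of $G$ (viewed as a set of edges). An edge $e\in T$ is internally semi-active if it points away from the component of $T\setminus\{e\}$ containing $r$, and internally semi-passive otherwise. For $e\in E\setminus T$, let $\mathrm{Cyc}_T(e)$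 be the unique cycle in $T\cup\{e\}$, oriented counter-clockwise around $q$ in $\mathbb{R}^2\cup\{\infty\}$ (so that the side containing $q$ lies on its left); $e$ is externally semi-active if its direction agrees with this orientation, and externally semi-passive otherwise. Let $\iota_+(T)$, $\overline{\iota}_+(T)$ be the numbers of internally semi-active, respectively semi-passive, edges in $T\cap E_+$, and $\varepsilon_-(T)$, $\overline{\varepsilon}_-(T)$ the numbers of externally semi-active, respectively semi-passive, edges in $E_-\setminus T$. The polynomial. For an alternating diagram $D$ of $K$ with Tait digraph $G$, a root $r$, and a basepoint $q$ in a face of $G$ adjacent to $r$ (its boundary contains $r$), $$P_K(x,y,z,w)=\sum_{T}x^{-\iota_+(T)}y^{-\overline{\iota}_+(T)}z^{\varepsilon_-(T)}w^{\overline{\varepsilon}_-(T)}\in\mathbb{Z}[x^{-1},y^{-1},z,w],$$ summed over all spanning trees $T$ of $G$. It does not depend on the choice of alternating diagram or of adjacent pair $(r,q)$. *)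

(* Defs.v *)
From HB Require Import structures.
From mathcomp Require Import all_boot all_order all_fingroup all_algebra.
From mathcomp Require Import -(notations) mpoly.
From mathcomp Require Import boolp ring.
Set Implicit Arguments.
Unset Strict Implicit.
Unset Printing Implicit Defensive.
Import Order.TTheory GRing.Theory Num.Theory.
Local Open Scope ring_scope.

(** * Combinatorial link diagrams *)

(* A passage (c, o) is one of the two traversals of the crossing c, the
   overpass if o = true and the underpass if o = false; next_passage p is the
   passage that follows p along its component, and positive c is the sign of
   c. *)
Record gauss_code := GaussCode {
  crossing : finType;
  next_passage : {perm crossing * bool};
  positive : pred crossing
}.

Section Diagram.
Variable D : gauss_code.
Local Notation C := (crossing D).

(* The dart (c, o, b) is the half-arc leaving c along the passage (c, o),
   forwards if b = true and backwards if b = false. *)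
Definition dart := (C * bool * bool)%type.

Definition arc (d : dart) : dart :=
  let: (p, b) := d in
  if b then (next_passage D p, false) else ((next_passage D)^-1%g p, true).

(* With both strands pointing upward, the four darts at a crossing are, in
   counter-clockwise order starting from the upper right,
     over-out, under-out, over-in, under-in   at a positive crossing,
     under-out, over-out, under-in, over-in   at a negative crossing;
   ccw and cw are the successor and the predecessor in this cyclic order. *)
Definition ccw (d : dart) : dart :=
  let: (c, o, b) := d in (c, ~~ o, if o == positive c then b else ~~ b).

Definition cw (d : dart) : dart :=
  let: (c, o, b) := d in (c, ~~ o, if o == positive c then ~~ b else b).

(* A region is encoded by the set of its corners, where d stands for the corner
   between d and ccw d.  That corner lies to the left of d; walking along the
   arc of d with the region on the left, the next corner is cw (arc d). *)
Definition region (d : dart) : {set dart} :=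
  [set d' | fconnect (fun x => cw (arc x)) d d'].

Definition connected_diagram : Prop :=
  forall c c' : C,
    connect (fun a b => [exists o, (next_passage D (a, o)).1 == b]) c c'.

(* Euler's formula for a connected 4-valent graph in the sphere, which has
   twice as many edges as vertices. *)
Definition planar_diagram : Prop :=
  #|[set region d | d : dart]| = (#|C| + 2)%N.

Definition alternating_code : Prop :=
  forall p : C * bool, (next_passage D p).2 = ~~ p.2.

(** ** The Tait digraph *)

(* The edges are the crossings.  Rotate a crossing so that its overstrand runs
   from lower left to upper right: the dart over-out is then the upper right
   one and the dart over-in the lower left one, so that their corners are the
   top and the bottom one. *)
Definition head_vertex (c : C) : {set dart} := region (c, true, true).
Definition tail_vertex (c : C) : {set dart} := region (c, true, false).

Definition vertices : {set {set dart}} :=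
  [set tail_vertex c | c : C] :|: [set head_vertex c | c : C].

(* The faces of the Tait digraph correspond to the unshaded regions; these are
   the ones to the left and to the right of the edge c. *)
Definition left_face (c : C) : {set dart} := region (ccw (c, true, true)).
Definition right_face (c : C) : {set dart} := region (ccw (c, true, false)).

(* The vertex r is on the boundary of the face q iff some edge at r has q on one
   of its two sides. *)
Definition adjacent_pair (r q : {set dart}) : Prop :=
  exists c, ((r == tail_vertex c) || (r == head_vertex c))
         && ((q == left_face c) || (q == right_face c)).

Definition linked (S : {set C}) (u v : {set dart}) : bool :=
  connect (fun a b => [exists c in S,
    ((a == tail_vertex c) && (b == head_vertex c)) ||
    ((a == head_vertex c) && (b == tail_vertex c))]) u v.

(* (c, true) is the edge c traversed in its direction, (c, false) the same edge
   traversed backwards. *)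
Definition src (g : C * bool) := if g.2 then tail_vertex g.1 else head_vertex g.1.
Definition tgt (g : C * bool) := if g.2 then head_vertex g.1 else tail_vertex g.1.
Definition left_of (g : C * bool) :=
  if g.2 then left_face g.1 else right_face g.1.

Definition simple_cycle (s : seq (C * bool)) : bool :=
  [&& s != [::], path.cycle (fun g h => tgt g == src h) s,
      uniq [seq src g | g <- s] & uniq [seq g.1 | g <- s]].

Definition within_edges (S : {set C}) (s : seq (C * bool)) : bool :=
  all (fun g => g.1 \in S) s.

Definition spanning_tree (T : {set C}) : Prop :=
  {in vertices &, forall u v, linked T u v} /\
  ~ (exists s, simple_cycle s && within_edges T s).

(* The complement of the cycle s in the sphere has two components, each of them
   glued from faces along the edges that are not in s. *)
Definition on_left (s : seq (C * bool)) (q : {set dart}) : Prop :=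
  exists2 g, g \in s &
    connect (fun a b => [exists c,
      (c \notin [seq h.1 | h <- s]) &&
      (((a == left_face c) && (b == right_face c)) ||
       ((a == right_face c) && (b == left_face c)))]) (left_of g) q.

(** ** Activities *)

Definition int_semi_active (r : {set dart}) (T : {set C}) (e : C) : bool :=
  linked (T :\ e) r (tail_vertex e).

Definition ext_semi_active (q : {set dart}) (T : {set C}) (e : C) : bool :=
  `[< exists s, [/\ simple_cycle s, within_edges (e |: T) s, on_left s q
                  & (e, true) \in s] >].

Definition iota_pos r (T : {set C}) : nat :=
  #|[set e in T | positive e && int_semi_active r T e]|.
Definition iotabar_pos r (T : {set C}) : nat :=
  #|[set e in T | positive e && ~~ int_semi_active r T e]|.
Definition eps_neg q (T : {set C}) : nat :=
  #|[set e in ~: T | ~~ positive e && ext_semi_active q T e]|.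
Definition epsbar_neg q (T : {set C}) : nat :=
  #|[set e in ~: T | ~~ positive e && ~~ ext_semi_active q T e]|.

(* Z[x^-1, y^-1, z, w] is the ring of polynomials in four generators, which
   are x^-1, y^-1, z and w in this order. *)
Definition tait_polynomial (r q : {set dart}) : mpoly 4 int :=
  \sum_(T : {set C} | `[< spanning_tree T >])
     mpolyX int (Multinom
       [tuple iota_pos r T; iotabar_pos r T; eps_neg q T; epsbar_neg q T]).

End Diagram.

(* The value at (x, y, z, w) of an element of Z[x^-1, y^-1, z, w]. *)
Definition peval (F : fieldType) (P : mpoly 4 int) (x y z w : F) : F :=
  mmap (fun n : int => n%:~R) (tnth [tuple x^-1; y^-1; z; w]) P.

(* The field of rational functions Q(x, y, z, w), in which
   Z[x, x^-1, y, y^-1, z, z^-1, w, w^-1] is a subring, and its i-th variable. *)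
Definition ratfun4 : fieldType := {fraction mpoly 4 int}.
Definition ratvar (i : 'I_4) : ratfun4 :=
  tofrac (mpolyX int (mnm1 i)).

(** * Oriented links and isotopy *)

From mathcomp Require Import all_classical all_reals all_analysis.
Import numFieldNormedType.Exports.
Local Open Scope classical_set_scope.
Local Open Scope ring_scope.

(* Links in S^3 are moved off the point at infinity.  Every component is
   parametrized over R/Z and oriented by its parametrization.  No tameness is
   imposed: it follows from the existence of a diagram. *)
Record link (R : realType) := Link {
  ncomp : nat;
  strand : 'I_ncomp.+1 -> R -> 'rV[R]_3;
  strand_continuous : forall i, continuous (strand i);
  strand_periodic : forall i t, strand i (t + 1) = strand i t;
  strand_inj : forall i j s t, strand i s = strand j t ->
    i = j /\ exists n : int, s = t + n%:~R
}.
Arguments strand {R} l i t.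
Arguments ncomp {R} l.

Section Links.
Variable R : realType.
Implicit Types K L : link R.

Definition support K : set 'rV[R]_3 := [set v | exists i t, strand K i t = v].

Definition ambient_isotopy (H : R -> 'rV[R]_3 -> 'rV[R]_3) : Prop :=
  [/\ {within [set p : R * 'rV[R]_3 | 0 <= p.1 <= 1],
         continuous (fun p => H p.1 p.2)},
      forall v, H 0 v = v
    & forall t, 0 <= t <= 1 -> exists G,
        [/\ continuous (H t), continuous G, cancel (H t) G & cancel G (H t)]].

(* The bijection sigma matches the components and the maps phi i, which are
   lifts of orientation-preserving homeomorphisms of R/Z, the
   parametrizations. *)
Definition isotopic K L : Prop :=
  exists H (sigma : 'I_(ncomp K).+1 -> 'I_(ncomp L).+1)
         (phi : 'I_(ncomp K).+1 -> R -> R),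
    [/\ ambient_isotopy H, bijective sigma,
        forall i, [/\ continuous (phi i), {homo phi i : s t / s < t}
                    & forall t, phi i (t + 1) = phi i t + 1]
      & forall i t, strand L (sigma i) (phi i t) = H 1 (strand K i t)].

Lemma rev_continuous K i : continuous (fun t => strand K i (- t)).
Proof.
move=> t; apply: (@continuous_comp _ _ _ (fun t : R => - t) (strand K i)).
  exact: opp_continuous.
exact: strand_continuous.
Qed.

Lemma rev_periodic K i t : strand K i (- (t + 1)) = strand K i (- t).
Proof. by rewrite -(strand_periodic i (- (t + 1))) opprD addrNK. Qed.

Lemma rev_inj K i j s t : strand K i (- s) = strand K j (- t) ->
  i = j /\ exists n : int, s = t + n%:~R.
Proof.
move=> /strand_inj[-> [n e]]; split=> //; exists (- n).
by rewrite rmorphN /= -[s]opprK e opprD opprK.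
Qed.

Definition reverse K : link R :=
  Link (@rev_continuous K) (@rev_periodic K) (@rev_inj K).

(* The reflection in the plane of projection. *)
Definition reflect3 (v : 'rV[R]_3) : 'rV[R]_3 :=
  v - (2 * v 0 2) *: delta_mx 0 2.

Lemma reflect3K : involutive reflect3.
Proof.
move=> v; rewrite /reflect3; apply/rowP => j; rewrite !mxE !eqxx /=.
by case: (j == 2); rewrite /= ?mulr1 ?mulr0 ?subr0 //; ring.
Qed.

Lemma reflect3_continuous : continuous reflect3.
Proof.
move=> v.
apply: (@cvgB R _ _ (nbhs v) _ (fun u => u)
         (fun u : 'rV[R]_3 => (2 * u 0 2) *: delta_mx 0 2)).
  exact: cvg_id.
apply: cvgZr_tmp; apply: cvgMl_tmp.
exact: coord_continuous.
Qed.

Lemma mir_continuous K i : continuous (fun t => reflect3 (strand K i t)).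
Proof.
move=> t; apply: (@continuous_comp _ _ _ (strand K i) reflect3).
  exact: strand_continuous.
exact: reflect3_continuous.
Qed.

Lemma mir_periodic K i t :
  reflect3 (strand K i (t + 1)) = reflect3 (strand K i t).
Proof. by rewrite strand_periodic. Qed.

Lemma mir_inj K i j s t :
  reflect3 (strand K i s) = reflect3 (strand K j t) ->
  i = j /\ exists n : int, s = t + n%:~R.
Proof. by move=> /(can_inj reflect3K) /strand_inj. Qed.

Definition mirror K : link R :=
  Link (@mir_continuous K) (@mir_periodic K) (@mir_inj K).

Definition invertible K : Prop := isotopic K (reverse K).
Definition amphichiral K : Prop := isotopic K (mirror K).

Definition split_link K : Prop :=
  exists f : 'rV[R]_3 -> 'rV[R]_3,
    let sphere := [set v : 'rV[R]_3 | \sum_i v 0 i ^+ 2 = 1] in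
    [/\ {within sphere, continuous f}, {in sphere &, injective f},
        f @` sphere `&` support K = set0
      & exists p q, [/\ support K p, support K q
                      & ~ connected_component (~` (f @` sphere)) p q]].

(** ** Diagrams of links *)

Definition xy (v : 'rV[R]_3) : R * R := (v 0 0, v 0 1).
Definition height (v : 'rV[R]_3) : R := v 0 2.

Definition velocity_defined L i t : Prop :=
  derivable (fun s => strand L i s 0 0) t 1 /\
  derivable (fun s => strand L i s 0 1) t 1.
Definition velocity L i t : R * R :=
  (derive1 (fun s => strand L i s 0 0) t,
   derive1 (fun s => strand L i s 0 1) t).
Definition det2 (u v : R * R) : R := u.1 * v.2 - u.2 * v.1.

(* The projection of L to the xy-plane, seen from above, is a regular
   projection with finitely many transverse double points and no other
   multiple points, with signed Gauss code D; the passage p takes place on the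
   component comp p at time (time p).  Every component has to meet a crossing,
   as the code does not record the others. *)
Definition projects_to L (D : gauss_code) : Prop :=
  exists (comp : crossing D * bool -> 'I_(ncomp L).+1)
         (time : crossing D * bool -> R),
    let point p := strand L (comp p) (time p) in
    [/\ injective point /\ (forall i, exists p, comp p = i),
        (forall c, xy (point (c, true)) = xy (point (c, false)) /\
                   height (point (c, false)) < height (point (c, true))),
        (forall u v, support L u -> support L v -> xy u = xy v ->
           u = v \/ exists c o, u = point (c, o) /\ v = point (c, ~~ o)),
        (forall p, exists t, [/\ time p < t,
           strand L (comp p) t = point (next_passage D p)
         & forall s p', time p < s < t -> strand L (comp p) s <> point p'])
      & (forall c,
           let v o := velocity (comp (c, o)) (time (c, o)) in
           [/\ forall o, velocity_defined (comp (c, o)) (time (c, o)),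
               det2 (v true) (v false) != 0
             & positive c = (0 < det2 (v true) (v false))])].

(* Diagrams of non-split links are connected. *)
Definition diagram_of (D : gauss_code) K : Prop :=
  [/\ connected_diagram D, planar_diagram D
    & exists2 L, isotopic K L & projects_to L D].

Definition alternating_link K : Prop :=
  exists2 D, diagram_of D K & alternating_code D.

(** ** The invariant *)

(* P is the common value of the tree sums of all alternating diagrams of K and
   all adjacent pairs (r, q). *)
Definition is_link_polynomial K (P : mpoly 4 int) : Prop :=
  alternating_link K /\
  forall (D : gauss_code) (r q : {set dart D}),
    diagram_of D K -> alternating_code D -> adjacent_pair r q ->
    tait_polynomial r q = P.

(* The unique P as above; the default value 0 only serves to make the function
   total. *)
Definition link_polynomial K : mpoly 4 int :=
  xget 0 [set P | is_link_polynomial K P].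

Definition P_ K (F : fieldType) (x y z w : F) : F :=
  peval (link_polynomial K) x y z w.

End Links.

(* Main.v *)
(* Reversing a diagram or switching all its crossings gives a diagram of the
   reverse or of the mirror image, hence another diagram of K when K is
   invertible or amphichiral, so it suffices to compare the two tree sums.
   Reversal turns every Tait edge around and keeps the signs, so that
   semi-active and semi-passive edges are exchanged.  Switching the crossings
   replaces the Tait digraph by its plane dual, changes the signs, and exchanges
   r and q; a spanning tree T is replaced by its complement.

   Both comparisons rest on one fact: e outside T is externally semi-active iff
   q can be joined to the face on the left of e without crossing T and e.  The
   side of the fundamental cycle is controlled by integral flows: the coboundary
   of a function on the faces is a flow, and a flow supported on a tree
   vanishes.  Euler's formula only enters to show that the complement of T has
   no dual cycle. *)
From mathcomp Require Import all_boot all_order all_fingroup all_algebra.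
From mathcomp Require Import ring lra zify.
From mathcomp Require Import -(notations) mpoly.
From mathcomp Require Import boolp reals.
Require Import Defs.
Set Implicit Arguments.
Unset Strict Implicit.
Unset Printing Implicit Defensive.
Import Order.TTheory GRing.Theory Num.Theory.
Local Open Scope ring_scope.

(** * Connectivity, cycles and flows in finite graphs *)

Section Graph.
Variables (C V : finType) (a b : C -> V).
Implicit Types (S T : {set C}) (e c : C) (u v x y : V).

Definition joins c x y :=
  ((x == a c) && (y == b c)) || ((x == b c) && (y == a c)).

(* The definitions of this section turn into those of the Tait digraph, up to
   conversion, for the ends tail_vertex and head_vertex, and describe its dual
   for the ends left_face and right_face. *)
Definition glinked S : rel V :=
  connect (fun x y => [exists c in S, joins c x y]).

Lemma joins_sym c x y : joins c x y = joins c y x.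
Proof. by rewrite /joins orbC ![(_ == b c) && _]andbC. Qed.

Lemma glinked_sym S x y : glinked S x y = glinked S y x.
Proof.
apply: sym_connect_sym => {}x {}y.
by apply: eq_existsb => c; rewrite joins_sym.
Qed.

Lemma glinked_trans S y x z : glinked S x y -> glinked S y z -> glinked S x z.
Proof. exact: connect_trans. Qed.

Lemma glinked_edge S c : c \in S -> glinked S (a c) (b c).
Proof.
move=> cS; apply: connect1; apply/exists_inP; exists c => //.
by rewrite /joins !eqxx.
Qed.

Lemma glinked_sub S T : S \subset T -> subrel (glinked S) (glinked T).
Proof.
move=> ST; apply: connect_sub => x y /exists_inP[c cS xy].
apply/connect1/exists_inP; exists c => //; exact: subsetP ST _ cS.
Qed.

(** With an indicator function for [phi], this stands in for inductions along paths in the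
    separation arguments below. *)
Lemma glinked_const (A : Type) (phi : V -> A) S x y :
  {in S, forall c, phi (a c) = phi (b c)} -> glinked S x y -> phi x = phi y.
Proof.
move=> phiS /connectP[p + ->]; elim: p x => //= z p IH x.
case/andP=> /exists_inP[c /phiS phic xz] /IH <-.
by case/orP: xz => /andP[/eqP-> /eqP->].
Qed.

(* A set of vertices of a connected graph avoiding a fixed vertex is determined
   by the edges with exactly one end in it. *)
Lemma leq_card_linked S (W : {set V}) :
  {in W &, forall x y, glinked S x y} -> (#|W| <= #|S| + 1)%N.
Proof.
move=> WS; have [->|[r rW]] := set_0Vmem W; first by rewrite cards0.
rewrite (cardsD1 r) rW addnC leq_add2r.
(* Passing to powers of 2 reduces the bound to an injection of the subsets of [W :\ r] into those of
   [S]. *)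
rewrite -(@leq_exp2l 2) // -!card_powerset.
pose d (A : {set V}) := [set c in S | (a c \in A) (+) (b c \in A)].
suff <- : #|d @: powerset (W :\ r)| = #|powerset (W :\ r)|.
  apply/subset_leq_card/subsetP => _ /imsetP[A _ ->].
  by rewrite inE; apply/subsetP => c; rewrite inE => /andP[].
apply: card_in_imset => A B; rewrite !inE => AW BW dAB; apply/setP => x.
have [xW|xW] := boolP (x \in W :\ r); last first.
  by rewrite !(contraNF (subsetP _ _) xW).
have rx : glinked S r x by apply: WS => //; case/setD1P: xW.
have rNA : r \notin A by apply/negP => /(subsetP AW); rewrite !inE eqxx.
have rNB : r \notin B by apply/negP => /(subsetP BW); rewrite !inE eqxx.
(* The indicator of the symmetric difference of [A] and [B] is constant along [S] and vanishes at
   [r]. *)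
suff : (r \in A) (+) (r \in B) = (x \in A) (+) (x \in B).
  by rewrite (negbTE rNA) (negbTE rNB); case: (x \in A); case: (x \in B).
apply: (glinked_const (phi := fun x => (x \in A) (+) (x \in B))) rx => c cS.
move/setP/(_ c): dAB; rewrite !inE cS /=.
by do 4!case: (_ \in _).
Qed.

(** A path cut at its first use of [e] ends at an end of [e]. Formally, reaching one of these ends
    without [e] is a property preserved by all edges of [S]. *)
Lemma glinkedD1 S e x : e \in S -> glinked S x (a e) ->
  glinked (S :\ e) x (a e) || glinked (S :\ e) x (b e).
Proof.
move=> eS.
set phi := fun x => glinked (S :\ e) x (a e) || glinked (S :\ e) x (b e).
move=> /(glinked_const (phi := phi)) E; rewrite -/(phi x) E.
  by rewrite /phi /glinked connect0.
move=> c cS; rewrite /phi; have [->|ce] := eqVneq c e.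
  by rewrite /glinked !connect0 orbT.
have cSe : c \in S :\ e by rewrite !inE ce.
have cab := glinked_edge cSe; have cba := cab; rewrite glinked_sym in cba.
by congr (_ || _); apply/idP/idP; apply: glinked_trans.
Qed.

(** Acyclicity as a condition on cuts, the form suited to flows and duality; [acyclicP] relates it
    to simple cycles. *)
Definition bridges S := {in S, forall e, ~~ glinked (S :\ e) (a e) (b e)}.

(** Deleting a bridge separates its two ends, so exactly one of them stays with [x]. This dichotomy
    is what exchanges semi-active and semi-passive edges. *)
Lemma glinked_bridge S e x : bridges S -> e \in S -> glinked S x (a e) ->
  glinked (S :\ e) x (b e) = ~~ glinked (S :\ e) x (a e).
Proof.
move=> /(_ e) + eS => /(_ eS) br /(glinkedD1 eS).
case xa: (glinked _ x (a e)); case xb: (glinked _ x (b e)) => //= _.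
by rewrite (glinked_trans _ xb) // glinked_sym in br.
Qed.

(** * Oriented walks and simple cycles *)

Definition gsrc (g : C * bool) := if g.2 then a g.1 else b g.1.
Definition gtgt (g : C * bool) := if g.2 then b g.1 else a g.1.

Definition gsimple (s : seq (C * bool)) : bool :=
  [&& s != [::], path.cycle (fun g h => gtgt g == gsrc h) s,
      uniq [seq gsrc g | g <- s] & uniq [seq g.1 | g <- s]].

Lemma joinsP c x y : reflect (exists o, x = gsrc (c, o) /\ y = gtgt (c, o))
  (joins c x y).
Proof.
apply: (iffP orP) => [[]/andP[/eqP-> /eqP->]|[[] [-> ->]]].
- by exists true.
- by exists false.
- by left; rewrite !eqxx.
- by right; rewrite !eqxx.
Qed.

(** Consecutive edges share a vertex, so sources and targets are the same list up to a shift. *)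
Lemma walk_gtgt g s : path (fun g h => gtgt g == gsrc h) g s ->
  rcons [seq gsrc h | h <- s] (gtgt (last g s)) =
  gtgt g :: [seq gtgt h | h <- s].
Proof. by elim: s g => //= h s IH g /andP[/eqP-> /IH->]. Qed.

(** The edge [g] only supplies the starting vertex; keeping it lets the walk be closed up by [g]
    later. Edges are distinct because the vertices of a shortened path are. *)
Lemma walk_of_linked S g y : glinked S (gtgt g) y ->
  exists s, [/\ path (fun g h => gtgt g == gsrc h) g s, gtgt (last g s) = y,
    all (fun h => h.1 \in S) s, uniq (gtgt g :: [seq gtgt h | h <- s])
    & uniq [seq h.1 | h <- s]].
Proof.
move=> /connectP[p pth ->]; case/shortenP: pth => {}p pth up _ {y}.
suff [s [ps -> Ss u1 u2]] : exists s,
  [/\ path (fun g h => gtgt g == gsrc h) g s,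
    p = [seq gtgt h | h <- s], all (fun h => h.1 \in S) s,
    uniq (gtgt g :: [seq gtgt h | h <- s]) & uniq [seq h.1 | h <- s]].
  by exists s; split=> //; rewrite last_map.
elim: p g pth up => [|z p IH] g /=; first by exists [::].
move=> /andP[/exists_inP[c cS /joinsP[o [gE zE]]]].
rewrite zE => pth /andP[gNp up].
have [s [ps pE Ss us1 us2]] := IH _ pth up.
exists ((c, o) :: s); split=> //=.
- by rewrite gE eqxx.
- by rewrite pE.
- by rewrite cS.
- by rewrite -pE gNp up.
(* A repeated edge would repeat the vertex gtgt g. *)
rewrite us2 andbT; apply: contra gNp => /mapP[h hs cE].
have -> : gtgt g = if o == h.2 then gsrc h else gtgt h.
  by rewrite gE cE /gsrc /gtgt /=; case: o {gE zE pth us1 IH up ps}; case: h.2.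
rewrite pE; case: ifP => _; last by rewrite inE map_f ?orbT.
by rewrite -(walk_gtgt ps) mem_rcons inE map_f ?orbT.
Qed.

Lemma simple_cycle_of_linked S e : e \notin S -> glinked S (b e) (a e) ->
  exists s, gsimple ((e, true) :: s) && all (fun h => h.1 \in S) s.
Proof.
move=> eNS /(@walk_of_linked S (e, true))[s [ps ls Ss us1 us2]].
exists s; rewrite Ss andbT /gsimple /= us2 andbT rcons_path ps ls eqxx /=.
move: us1; rewrite -(walk_gtgt ps) rcons_uniq ls => -> /=.
by apply/mapP => -[h /(allP Ss) hS eE]; rewrite eE hS in eNS.
Qed.

Lemma linked_of_walk S g s : path (fun g h => gtgt g == gsrc h) g s ->
  all (fun h => h.1 \in S) s -> glinked S (gtgt g) (gtgt (last g s)).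
Proof.
elim: s g => [|h s IH] g /=; first by rewrite /glinked connect0.
move=> /andP[/eqP-> ps] /andP[hS Ss]; apply: (glinked_trans _ (IH _ ps Ss)).
apply/connect1/exists_inP; exists h.1 => //; apply/joinsP.
by exists h.2; rewrite -surjective_pairing.
Qed.

(** Once the cycle is rotated to start with [g], its remainder joins the ends of [g] without using
    [g]. *)
Lemma linked_of_simple_cycle T s g : gsimple s -> all (fun h => h.1 \in T) s ->
  g \in s -> glinked (T :\ g.1) (a g.1) (b g.1).
Proof.
case/and4P=> _ cyc _ us sT gs; have [i s' sE] := rot_to gs.
rewrite -(rot_cycle i) sE /= rcons_path in cyc; case/andP: cyc => ps /eqP ls.
rewrite -(rot_uniq i) -map_rot sE /= in us; case/andP: us => gNs us.
suff: glinked (T :\ g.1) (gtgt g) (gsrc g).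
  by rewrite /gtgt /gsrc; case: g.2; rewrite // glinked_sym.
rewrite -ls; apply: linked_of_walk ps _; apply/allP => h hs.
rewrite !inE (contraNneq _ gNs) => [|<-]; last exact: map_f.
by apply: (allP sT); rewrite -(mem_rot i) sE inE hs orbT.
Qed.

(** The rest of a cycle through an edge reconnects its ends, and a path reconnecting them closes up
    to a cycle. *)
Lemma acyclicP S :
  ~ (exists s, gsimple s && all (fun h => h.1 \in S) s) <-> bridges S.
Proof.
split=> [acyc e eS|br [[|g s] /andP[//]]]; last first.
  move=> sc /[dup] gS /andP[/= gS' _].
  by have /negP[] := br _ gS'; apply: linked_of_simple_cycle sc gS _;
    apply: mem_head.
apply/negP; rewrite glinked_sym.
case/(simple_cycle_of_linked (negbT (setD11 e S))) => s /andP[sc /allP sS];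
  apply: acyc; exists ((e, true) :: s).
by rewrite sc /= eS; apply/allP => h /sS /setD1P[].
Qed.

Definition gvertices : {set V} := [set a c | c : C] :|: [set b c | c : C].

Lemma gverticesP u : reflect (exists c, u = a c \/ u = b c) (u \in gvertices).
Proof.
apply: (iffP setUP) => [[]/imsetP[c _ ->]|[c []->]]; try by exists c; auto.
  by left; apply: imset_f.
by right; apply: imset_f.
Qed.

Definition gspanning T :=
  {in gvertices &, forall u v, glinked T u v} /\ bridges T.

(** * Integral flows and Kirchhoff's law *)

Definition flow (f : C -> int) :=
  forall v, \sum_c f c * ((a c == v)%:R - (b c == v)%:R) = 0.

(** Kirchhoff's law is summed over the vertices in [A]. *)
Lemma flow_cut f (A : {set V}) : flow f ->
  \sum_c f c * ((a c \in A)%:R - (b c \in A)%:R) = 0.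
Proof.
have ind x : (x \in A)%:R = \sum_(v in A) (x == v)%:R :> int.
  have [xA|xNA] := boolP (x \in A).
    rewrite (bigD1 x) //= eqxx big1 ?addr0 // => v /andP[_ /negbTE].
    by rewrite eq_sym => ->.
  by rewrite big1 // => v vA; rewrite (negbTE (contraNneq _ xNA)) // => ->.
move=> fl.
transitivity (\sum_(v in A) \sum_c f c * ((a c == v)%:R - (b c == v)%:R)).
  rewrite exchange_big; apply: eq_bigr => c _ /=.
  by rewrite -mulr_sumr sumrB -!ind.
by apply: big1 => v _; apply: fl.
Qed.

(** For [e] in [T], the component of [b e] in [T :\ e] has a boundary meeting [T] only in [e], so
    the net flow across it is that of [e] alone, up to sign. *)
Lemma flow_bridges f T : flow f -> bridges T ->
  (forall c, c \notin T -> f c = 0) -> forall c, f c = 0.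
Proof.
move=> fl br fT e; have [eT|/fT//] := boolP (e \in T).
have := flow_cut [set x | glinked (T :\ e) (b e) x] fl.
rewrite (bigD1 e) //= big1 => [|c ce]; last first.
  have [cT|/fT->] := boolP (c \in T); last by rewrite mul0r.
  rewrite !inE; have /glinked_edge cS : c \in T :\ e by rewrite !inE ce.
  suff -> : glinked (T :\ e) (b e) (a c) = glinked (T :\ e) (b e) (b c).
    by rewrite subrr mulr0.
  apply/idP/idP; last rewrite glinked_sym in cS; by move/glinked_trans; apply.
rewrite !inE glinked_sym (negbTE (br e eT)) /glinked connect0.
by rewrite sub0r mulrN1 addr0 => /eqP; rewrite oppr_eq0 => /eqP.
Qed.

Definition cycle_flow (s : seq (C * bool)) c : int :=
  ((c, true) \in s)%:R - ((c, false) \in s)%:R.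

(** A closed walk enters each vertex as often as it leaves it: its targets are a rotation of its
    sources. *)
Lemma cycle_flowP s : gsimple s -> flow (cycle_flow s).
Proof.
case/and4P=> _ cyc us _ v; have {}us := map_uniq us.
have -> : \sum_c cycle_flow s c * ((a c == v)%:R - (b c == v)%:R)
    = \sum_(g <- s) ((gsrc g == v)%:R - (gtgt g == v)%:R).
  rewrite (big_uniq _ us) [RHS]big_mkcond.
  transitivity (\sum_c \sum_(o : bool)
      if (c, o) \in s then (gsrc (c, o) == v)%:R - (gtgt (c, o) == v)%:R : int
      else 0).
    apply: eq_bigr => c _; rewrite big_bool /cycle_flow /=.
    by case: (_ \in _); case: (_ \in _); rewrite /gsrc /gtgt /=; ring.
  by rewrite pair_bigA; apply: eq_bigr => -[].
suff E : \sum_(g <- s) (gsrc g == v)%:R = \sum_(g <- s) (gtgt g == v)%:R :> int.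
  by rewrite sumrB E subrr.
rewrite -(big_map gsrc xpredT (fun x => (x == v)%:R)).
rewrite -(big_map gtgt xpredT (fun x => (x == v)%:R)).
apply: perm_big; case: s cyc {us} => //= g s; rewrite rcons_path.
case/andP=> /walk_gtgt <- /eqP ->.
by rewrite perm_sym perm_rcons.
Qed.

End Graph.

(** * Trees of the Tait digraph and of its dual *)

Section Regions.
Variable D : gauss_code.
Implicit Types (c e : crossing D) (d : dart D) (S T : {set crossing D}).
Implicit Types (u v : {set dart D}).

(** * Regions as orbits of the boundary walk *)

Definition step d := cw (arc d).

Lemma arcK : involutive (@arc D).
Proof. by move=> [p []] /=; rewrite ?permK ?permKV. Qed.

Lemma cwK : cancel (@cw D) (@ccw D).
Proof. by move=> [[c []] []]; rewrite /ccw /cw; case: (positive c). Qed.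

Lemma step_inj : injective step.
Proof. exact: inj_comp (can_inj cwK) (inv_inj arcK). Qed.

Lemma eq_region d d' : (region d == region d') = fconnect step d d'.
Proof.
have sym := fconnect_sym step_inj.
apply/eqP/idP => [/setP/(_ d')|dd']; first by rewrite !inE connect0.
by apply/setP => x; rewrite !inE; apply: same_connect dd' x.
Qed.

Lemma region_step d : region (step d) = region d.
Proof. by apply/esym/eqP; rewrite eq_region fconnect1. Qed.

(** The corner to the right of [d] and the corner to the left of the opposite dart lie on the same
    side of their arc. *)
Lemma region_cw d : region (cw d) = region (arc d).
Proof. by rewrite -[in LHS](arcK d) region_step. Qed.

Lemma region_over c b :
  region (c, true, b) = if b then head_vertex c else tail_vertex c.
Proof. by case: b. Qed.

Lemma region_under c b :
  region (c, false, b) = if b == positive c then left_face c else right_face c.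
Proof. by rewrite /left_face /right_face /=; case: b; case: (positive c). Qed.

Lemma region_ccw c b :
  region (ccw (c, true, b)) = if b then left_face c else right_face c.
Proof. by case: b. Qed.

Definition faces : {set {set dart D}} :=
  gvertices (@left_face D) (@right_face D).

Lemma left_faces c : left_face c \in faces.
Proof. by rewrite inE imset_f. Qed.
Lemma right_faces c : right_face c \in faces.
Proof. by rewrite inE imset_f ?orbT. Qed.
Lemma tail_vertices c : tail_vertex c \in vertices D.
Proof. by rewrite inE imset_f. Qed.
Lemma head_vertices c : head_vertex c \in vertices D.
Proof. by rewrite inE imset_f ?orbT. Qed.

Lemma facesP u :
  reflect (exists c, u = left_face c \/ u = right_face c) (u \in faces).
Proof. exact: gverticesP. Qed.

Lemma verticesP u :
  reflect (exists c, u = tail_vertex c \/ u = head_vertex c) (u \in vertices D).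
Proof. exact: gverticesP. Qed.

Lemma adjacent_pair_mem u v :
  adjacent_pair u v -> u \in vertices D /\ v \in faces.
Proof.
move=> [c /andP[uc vc]]; split.
  by apply/verticesP; exists c; case/orP: uc => /eqP; [left|right].
by apply/facesP; exists c; case/orP: vc => /eqP; [left|right].
Qed.

Definition dual_linked S := glinked (@left_face D) (@right_face D) S.

Hypothesis alt : alternating_code D.

(* In an alternating diagram the corners (c, true, b) are the shaded ones and
   the corners (c, false, b) the unshaded ones. *)
Lemma step_layer d : (step d).1.2 = d.1.2.
Proof.
rewrite /step; case: d => p [] /=.
  by have := alt p; case: (next_passage D p) => c o /= ->; rewrite negbK.
have := alt ((next_passage D)^-1%g p); rewrite permKV.
by case: ((next_passage D)^-1%g p) => c o /= ->.
Qed.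

Lemma region_layer d d' : region d = region d' -> d.1.2 = d'.1.2.
Proof.
move/eqP; rewrite eq_region => /connectP[s + ->].
by elim: s d => //= x s IH d /andP[/eqP <- /IH <-]; rewrite step_layer.
Qed.

Lemma sum_overpasses (M : nmodType) (H : dart D -> M) :
  \sum_(d | d.1.2) H d = \sum_c (H (c, true, true) + H (c, true, false)).
Proof.
rewrite [LHS]big_mkcond.
transitivity (\sum_(p : crossing D * bool) \sum_b if p.2 then H (p, b) else 0).
  by rewrite pair_bigA; apply: eq_bigr => -[].
transitivity (\sum_(c : crossing D) \sum_o \sum_b if o then H (c, o, b) else 0).
  by rewrite [RHS]pair_bigA; apply: eq_bigr => -[].
apply: eq_bigr => c _; rewrite big_bool /= big_bool.
by rewrite [X in _ + X]big1 ?addr0.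
Qed.

(* The sum at v telescopes along the corners of v. *)
Lemma coboundary_flow (phi : {set dart D} -> int) :
  flow (@tail_vertex D) (@head_vertex D)
    (fun c => phi (left_face c) - phi (right_face c)).
Proof.
move=> v.
pose G d : int := (region d == v)%:R * phi (region (ccw d)).
have : \sum_(d | d.1.2) (G (step d) - G d) = 0.
  rewrite sumrB [X in _ - X](reindex_inj step_inj) /=.
  under [X in _ - X]eq_bigl => d do rewrite step_layer.
  by rewrite subrr.
rewrite sum_overpasses => E; rewrite -[RHS]E; apply: eq_bigr => c _.
(* A shaded corner [d] of [v] now contributes [phi (region (cw d)) - phi (region (ccw d))], the
   difference between the faces on its two sides. *)
rewrite /G !region_step /step !cwK -!region_cw.
rewrite (region_ccw c true) (region_ccw c false).
rewrite (region_over c true) (region_over c false) /=.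
ring.
Qed.

(** * Euler's formula and the dual of a spanning tree *)

Hypothesis conn : connected_diagram D.
Hypothesis planar : planar_diagram D.

(** Every arc has an unshaded region on one side, which has a corner at both crossings that the arc
    joins; connectedness of the diagram does the rest. *)
Lemma faces_connected : {in faces &, forall u v, dual_linked setT u v}.
Proof.
have sym := glinked_sym (@left_face D) (@right_face D) setT.
have trans := @glinked_trans _ _ (@left_face D) (@right_face D) setT.
have lr c : dual_linked setT (left_face c) (right_face c).
  exact: glinked_edge.
have toL c b : dual_linked setT (region (c, false, b)) (left_face c).
  rewrite region_under; case: ifP => _; first exact: connect0.
  by rewrite /dual_linked sym.
have adj d d' : region d = region d' -> ~~ d.1.2 ->
    dual_linked setT (left_face d.1.1) (left_face d'.1.1).
  move=> dd'; have := region_layer dd'.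
  case: d d' dd' => [[c o] b] [[c' o'] b'] /= dd' ee /negbTE oF.
  rewrite -ee oF in dd'; apply: trans (toL c' b');
    rewrite -dd' /dual_linked sym.
  exact: toL.
have next p : dual_linked setT (left_face p.1) (left_face (next_passage D p).1).
  (* The unshaded side of the outgoing arc is its left after an underpass and its right after an
     overpass. *)
  have [oF|/negbNE oT] := boolP (~~ p.2).
    have := @adj (p, true) (step (p, true)) (esym (region_step _)) oF.
    by rewrite /step /=; case: (next_passage D p).
  have := @adj (cw (p, true)) (arc (p, true)) (region_cw _).
  by case: p oT => c [] //= _; apply.
have all c c' : dual_linked setT (left_face c) (left_face c').
  have /connectP[s + ->] := conn c c'; elim: s c => [|x s IH] c /=.
    by rewrite /dual_linked /glinked connect0.
  by move=> /andP[/existsP[o /eqP<-] /IH]; apply: trans; apply: next.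
have {}toL u : u \in faces -> exists c, dual_linked setT u (left_face c).
  move=> /facesP[c [->|->]]; exists c; first exact: connect0.
  by rewrite /dual_linked sym.
move=> u v /toL[c uc] /toL[c' vc']; apply: (trans _ _ _ uc);
  apply: (trans _ _ _ (all c c')).
by rewrite sym.
Qed.

(** By alternation no region has both shaded and unshaded corners, so vertices and faces partition
    the regions counted by [planar_diagram]. *)
Lemma card_vertices_faces : (#|vertices D| + #|faces| = #|crossing D| + 2)%N.
Proof.
rewrite -planar -cardsUI (_ : vertices D :&: faces = set0) ?cards0 ?addn0.
  congr #|pred_of_set _|; apply/setP => u; apply/setUP/imsetP => [[]|[[[c o] b]
    _ ->]].
  - by move=> /verticesP[c [->|->]]; [exists (c, true, false)|exists (c, true,
      true)].
  - by move=> /facesP[c [->|->]]; [exists (ccw (c, true, true))|exists (ccw (c,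
      true, false))].
  case: o.
    left; rewrite region_over; case: b; [exact: head_vertices|exact:
      tail_vertices].
  right; rewrite region_under; case: ifP => _;
    [exact: left_faces|exact: right_faces].
apply/setP => u; rewrite [RHS]inE; apply/negP => /setIP[/setUP uV /setUP uF].
have {uV} [b [c uE]] : exists b c, u = region (c, true, b).
  by case: uV => /imsetP[c _ ->]; [exists false|exists true]; exists c.
have {uF} [b' [c' uE']] : exists b c, u = region (c, false, b).
  by case: uF => /imsetP[c' _ ->]; eexists; exists c'.
by have := region_layer (etrans (esym uE) uE').
Qed.

Lemma spanning_treeP T :
  spanning_tree T <-> gspanning (@tail_vertex D) (@head_vertex D) T.
Proof.
by split=> -[cn ac]; split=> //; apply/(acyclicP (@tail_vertex D) (@head_vertex
  D)).
Qed.

Lemma int_semi_passive T e u : spanning_tree T -> u \in vertices D -> e \in T ->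
  linked (T :\ e) u (head_vertex e) = ~~ int_semi_active u T e.
Proof.
move=> /spanning_treeP[cn br] uV eT; apply: glinked_bridge => //.
exact/cn/tail_vertices.
Qed.

(** The indicator of the faces reachable from [u] off [T] has a coboundary supported on the forest
    [T]. This flow vanishes, so the indicator is constant on all faces. *)
Lemma dual_connected T : bridges (@tail_vertex D) (@head_vertex D) T ->
  {in faces &, forall u v, dual_linked (~: T) u v}.
Proof.
move=> br u v uF vF.
pose phi w : int := (dual_linked (~: T) u w)%:R.
have off c : c \notin T -> phi (left_face c) - phi (right_face c) = 0.
  move=> cT; have cl : dual_linked (~: T) (left_face c) (right_face c).
    by apply: glinked_edge; rewrite inE.
  suff -> : phi (left_face c) = phi (right_face c) by rewrite subrr.
  congr (nat_of_bool _)%:R; have cr := cl; rewrite /dual_linked in cr *.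
  rewrite glinked_sym in cr.
  by apply/idP/idP => /glinked_trans; apply.
have zero := flow_bridges (coboundary_flow phi) br off.
have : phi u = phi v.
  apply: glinked_const (faces_connected uF vF) => c _.
  by apply: subr0_eq; apply: zero.
rewrite /phi {1}/dual_linked /glinked connect0 => /esym/eqP.
by case: (dual_linked _ u v).
Qed.

(* If the dual edges other than e of the complement of T still connected the
   faces, then T and its complement would have too many edges for Euler's
   formula. *)
Lemma dual_bridges T : spanning_tree T ->
  bridges (@left_face D) (@right_face D) (~: T).
Proof.
move=> /spanning_treeP[cn br] e eT; apply/negP => lr.
have /leq_card_linked := cn.
have : {in faces &, forall u v, dual_linked (~: T :\ e) u v}.
  move=> u v uF vF; have := dual_connected br uF vF.
  apply: connect_sub => x y /exists_inP[c cT cxy].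
  (* A step across [e] is replaced by the detour [lr]. *)
  have [ce|ce] := eqVneq c e; last first.
    by apply/connect1/exists_inP; exists c; rewrite // !inE ce -in_setC.
  case/orP: cxy => /andP[/eqP-> /eqP->]; rewrite ce //.
  by rewrite -/(glinked _ _ _ _ _) glinked_sym.
(* The two bounds add up to [#|crossing D| + 1], one less than Euler's formula requires. *)
move=> /leq_card_linked /leq_add /[apply].
rewrite addnC card_vertices_faces; have := cardsC T;
  rewrite [#|~: T|](cardsD1 e) eT.
move=> <-; lia.
Qed.

Lemma on_leftP s q : on_left s q <->
  exists2 g, g \in s & dual_linked [set c | c \notin [seq h.1 | h <- s]]
    (left_of g) q.
Proof.
rewrite /dual_linked /glinked.
split=> -[g gs gq]; exists g => //; move: gq; congr (is_true _);
  by apply: eq_connect => x y; apply: eq_existsb => c; rewrite inE.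
Qed.

(** Trades the sides of a cycle for connectivity in the dual graph: the complement of [T] is a dual
    tree with [e] as a bridge, so [q] lies with exactly one of the two faces beside [e]. *)
Lemma ext_semi_activeE T e q : spanning_tree T -> q \in faces -> e \notin T ->
  ext_semi_active q T e = dual_linked (~: (e |: T)) q (left_face e).
Proof.
move=> st qF eT; have /spanning_treeP[cn br] := st.
have setE : ~: (e |: T) = ~: T :\ e by rewrite setCU setIC -setDE.
apply/asboolP/idP => [[s [sc sT /on_leftP[g gs gq] es]]|ql].
  apply/negPn; rewrite setE.
  have eCT : e \in ~: T by rewrite inE.
  have dbr := dual_bridges st.
  (* If [q] were not with the left face of [e], it would be with the right one. *)
  rewrite -(glinked_bridge dbr eCT); last exact/dual_connected/left_faces.
  apply/negP => qr.
  (* The coboundary of phi and the flow along s agree off T, hence everywhere: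
     so phi is 1 to the left of s and 0 to its right. *)
  pose phi w : int := (dual_linked (~: T :\ e) w (left_face e))%:R.
  have phiC c : c \in ~: T :\ e -> phi (left_face c) = phi (right_face c).
    move=> /(glinked_edge (@left_face D) (@right_face D)) cl.
    congr (nat_of_bool _)%:R; have cr := cl; rewrite glinked_sym in cr.
    by apply/idP/idP; apply: glinked_trans.
  have phile : phi (left_face e) = 1.
    by rewrite /phi /dual_linked /glinked connect0.
  have phire : phi (right_face e) = 0.
    by rewrite /phi /dual_linked glinked_sym (negbTE (dbr e eCT)).
  pose f c := cycle_flow s c - (phi (left_face c) - phi (right_face c)).
  have fl : flow (@tail_vertex D) (@head_vertex D) f.
    move=> v; under eq_bigr => c _ do rewrite mulrBl.
    by rewrite sumrB coboundary_flow (cycle_flowP sc) subrr.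
  have uniqs : uniq [seq g.1 | g <- s] by case/and4P: sc.
  have one c b : (c, b) \in s -> (c, ~~ b) \notin s.
    move=> cb; apply/negP => cnb.
    have [i s' sE] := rot_to cb; move: uniqs cnb.
    rewrite -(mem_rot i) -(rot_uniq i) -map_rot sE /= inE => /andP[cs' _]
      /predU1P[[]|].
      by case: b {cb sE}.
    by move=> /(map_f fst) cs; rewrite cs in cs'.
  have off c : c \notin T -> f c = 0.
    move=> cT; rewrite /f; have [->|ce] := eqVneq c e.
      by rewrite phile phire /cycle_flow es (negbTE (one _ _ es)).
    rewrite phiC ?inE ?ce // subrr /cycle_flow.
    have nb b : (c, b) \notin s.
      by apply/negP => /(allP sT); rewrite !inE /= (negbTE ce) (negbTE cT).
    by rewrite !(negbTE (nb _)).
  have zero := flow_bridges fl br off.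
  (* On [s] two values in {0, 1} differ by 1 or -1 according to the direction of traversal, which
     forces the value 1 on the left. *)
  have left1 : phi (left_of g) = 1.
    have := zero g.1; have := one g.1 g.2.
    rewrite -surjective_pairing gs => /(_ isT).
    rewrite /f /cycle_flow /left_of; case: g gs {gq} => c [] /= -> /negbTE ->;
      by rewrite /phi; case: dual_linked; case: dual_linked.
  (* [phi] does not change across edges off [s], so the value 1 reaches [q], against [qr]. *)
  suff : phi (left_of g) = phi q.
    have ql := dual_connected br qF (left_faces e).
    have := glinked_bridge dbr eCT ql; rewrite left1 /phi /dual_linked.
    by rewrite qr => /esym/negbTE ->.
  apply: glinked_const gq => c; rewrite inE => cs.
  have nb b : (c, b) \notin s by apply: contra cs => /(map_f fst).
  have := zero c; rewrite /f /cycle_flow !(negbTE (nb _)) subrr sub0r => /eqP.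
  by rewrite oppr_eq0 subr_eq0 => /eqP.
(* Conversely, a path in [T] from the head of [e] to its tail closes up to a cycle traversing [e]
   forwards. *)
have : linked T (head_vertex e) (tail_vertex e).
  by apply: cn; [apply: head_vertices|apply: tail_vertices].
move=> /(simple_cycle_of_linked eT)[s /andP[sc sT]].
exists ((e, true) :: s); split=> //; last exact: mem_head.
  rewrite /within_edges /= setU11 /=; apply/allP => h /(allP sT).
  by rewrite inE => ->; rewrite orbT.
apply/on_leftP; exists (e, true); first exact: mem_head.
(* The cycle lies in [e |: T], so a dual path avoiding this set crosses no edge of the cycle. *)
rewrite /dual_linked glinked_sym; apply: glinked_sub ql.
apply/subsetP => c; rewrite !inE /= !negb_or => /andP[-> cT] /=.
by apply: contra cT => /mapP[h /(allP sT) ? ->].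
Qed.

End Regions.

(** * Reversed and mirrored diagrams *)

Section GraphMap.
Variables (C V V' : finType) (a b : C -> V) (a' b' : C -> V') (h : V -> V').
Hypothesis h_inj : injective h.
Hypothesis hab : forall c,
  (a' c = h (a c) /\ b' c = h (b c)) \/ (a' c = h (b c) /\ b' c = h (a c)).

(** Connectivity ignores directions, so [hab] may flip edges one by one: reversal flips all of them,
    mirroring those with a given sign. *)
Lemma glinked_map S x y : glinked a' b' S (h x) (h y) = glinked a b S x y.
Proof.
apply/idP/idP => xy.
  (* The image under [h] of the component of [x], as a predicate on [V']. *)
  pose phi z := [exists z0, (h z0 == z) && glinked a b S x z0].
  have phiE z : phi (h z) = glinked a b S x z.
    apply/existsP/idP => [[z0 /andP[/eqP/h_inj->]]//|xz].
    by exists z; rewrite eqxx.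
  rewrite -phiE -(glinked_const (phi := phi) _ xy) ?phiE; first exact: connect0.
  move=> c /(glinked_edge a b) cl; have cr := cl; rewrite glinked_sym in cr.
  have E : glinked a b S x (a c) = glinked a b S x (b c).
    by apply/idP/idP => /glinked_trans; apply.
  by case: (hab c) => -[-> ->]; rewrite !phiE.
pose phi z := glinked a' b' S (h x) (h z).
rewrite -/(phi y) -(glinked_const (phi := phi) _ xy); first exact: connect0.
move=> c /(glinked_edge a' b') cl; have cr := cl; rewrite glinked_sym in cr.
by rewrite /phi; case: (hab c) cl cr => -[-> ->] cl cr;
  apply/idP/idP => /glinked_trans; apply.
Qed.

Lemma gvertices_map : gvertices a' b' = h @: gvertices a b.
Proof.
apply/setP => z; apply/setUP/imsetP => [[]/imsetP[c _ ->]|[x + ->]].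
- by case: (hab c) => -[-> _]; [exists (a c)|exists (b c)];
    rewrite // inE imset_f ?orbT.
- by case: (hab c) => -[_ ->]; [exists (b c)|exists (a c)];
    rewrite // inE imset_f ?orbT.
by case/setUP=> /imsetP[c _ ->]; case: (hab c) => -[ha hb];
  rewrite -?ha -?hb; [left|right|right|left]; apply: imset_f.
Qed.

Lemma gspanning_map T : gspanning a' b' T <-> gspanning a b T.
Proof.
rewrite /gspanning gvertices_map; split=> -[cn br]; split.
- by move=> u v uV vV; rewrite -glinked_map; apply: cn; apply: imset_f.
- by move=> e /br; case: (hab e) => -[-> ->]; rewrite glinked_map //
    glinked_sym.
- by move=> _ _ /imsetP[u uV ->] /imsetP[v vV ->]; rewrite glinked_map;
    apply: cn.
- by move=> e /br; case: (hab e) => -[-> ->]; rewrite glinked_map //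
    glinked_sym.
Qed.

End GraphMap.

Section RegionMap.
Variables (D D' : gauss_code) (f : dart D -> dart D').
Hypothesis f_bij : bijective f.
Hypothesis f_step : forall d, step (f d) = f (step d).

(** Regions are orbits of [step], with which [f] commutes. *)
Lemma region_map d : region (f d) = f @: region d.
Proof.
have [g fK gK] := f_bij.
have iterE n x : iter n (@step D') (f x) = f (iter n (@step D) x).
  by elim: n => //= n ->; rewrite f_step.
apply/setP => y; rewrite -(gK y) mem_imset; last exact: can_inj fK.
rewrite !inE; apply/idP/idP => /iter_findex.
  by rewrite iterE => /(can_inj fK) <-; apply: fconnect_iter.
by move=> <-; rewrite -iterE fconnect_iter.
Qed.

Lemma card_regions_map :
  #|[set region d | d : dart D']| = #|[set region d | d : dart D]|.
Proof.
have [g fK gK] := f_bij.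
rewrite -(card_imset _ (imset_inj (can_inj fK))) -imset_comp.
congr #|pred_of_set _|; apply/setP => A; apply/imsetP/imsetP => -[d _ ->].
  by exists (g d) => //=; rewrite -region_map gK.
by exists (f d) => //=; rewrite region_map.
Qed.

End RegionMap.

(** * Reversal of orientation *)

Section Reverse.
Variable D : gauss_code.

(** Both strands at a crossing turn around, so signs are kept. *)
Definition reverse_code : gauss_code :=
  @GaussCode (crossing D) (next_passage D)^-1%g (@positive D).

Definition reverse_dart (d : dart D) : dart reverse_code := (d.1, ~~ d.2).

Lemma reverse_dart_bij : bijective reverse_dart.
Proof. by exists reverse_dart => -[p b]; rewrite /reverse_dart /= negbK. Qed.

Lemma reverse_dart_step d : step (reverse_dart d) = reverse_dart (step d).
Proof.
case: d => p []; rewrite /step /reverse_dart /= ?invgK.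
  by case: (next_passage D p) => c o; case: ifP.
by case: ((next_passage D)^-1%g p) => c o; case: ifP.
Qed.

Definition reverse_region (u : {set dart D}) : {set dart reverse_code} :=
  reverse_dart @: u.

Lemma reverse_region_inj : injective reverse_region.
Proof. exact/imset_inj/bij_inj/reverse_dart_bij. Qed.

Lemma region_reverse d : region (reverse_dart d) = reverse_region (region d).
Proof. exact: region_map reverse_dart_bij reverse_dart_step d. Qed.

Lemma reverse_ends (c : crossing D) :
  [/\ tail_vertex (D := reverse_code) c = reverse_region (head_vertex c),
      head_vertex (D := reverse_code) c = reverse_region (tail_vertex c),
      left_face (D := reverse_code) c = reverse_region (right_face c)
    & right_face (D := reverse_code) c = reverse_region (left_face c)].
Proof.
split.
- by rewrite /head_vertex -region_reverse.
- by rewrite /tail_vertex -region_reverse.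
- by rewrite /right_face -region_reverse /left_face /reverse_dart /=;
    case: (positive c).
- by rewrite /left_face -region_reverse /right_face /reverse_dart /=;
    case: (positive c).
Qed.

Lemma linked_reverse (S : {set crossing D}) u v :
  linked (D := reverse_code) S (reverse_region u) (reverse_region v) =
  linked S u v.
Proof.
by apply: (glinked_map reverse_region_inj) => c; case: (reverse_ends c); right.
Qed.

Lemma dual_linked_reverse (S : {set crossing D}) u v :
  dual_linked (D := reverse_code) S (reverse_region u) (reverse_region v) =
  dual_linked S u v.
Proof.
by apply: (glinked_map reverse_region_inj) => c; case: (reverse_ends c); right.
Qed.

Lemma spanning_tree_reverse (T : {set crossing D}) :
  spanning_tree (D := reverse_code) T <-> spanning_tree T.
Proof.
rewrite !spanning_treeP.
by apply: (gspanning_map reverse_region_inj) => c; case: (reverse_ends c);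
  right.
Qed.

Lemma adjacent_pair_reverse (r q : {set dart D}) : adjacent_pair r q ->
  adjacent_pair (reverse_region r) (reverse_region q).
Proof.
move=> [c /andP[rc qc]]; exists c; case: (reverse_ends c) => -> -> -> ->.
by rewrite !(inj_eq reverse_region_inj) orbC rc orbC qc.
Qed.

Lemma planar_reverse : planar_diagram D -> planar_diagram reverse_code.
Proof.
rewrite /planar_diagram => <-.
exact: card_regions_map reverse_dart_bij reverse_dart_step.
Qed.

(** A chain of passages from [c'] to [c] is read backwards. *)
Lemma connected_reverse : connected_diagram D -> connected_diagram reverse_code.
Proof.
move=> conn c c'; have := conn c' c; have /= -> := connect_rev _ c c'.
congr is_true; apply: eq_connect => x y /=.
apply/existsP/existsP => -[o /eqP <-] /=.
  by exists (next_passage D (x, o)).2; rewrite -surjective_pairing permK.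
exists ((next_passage D)^-1%g (y, o)).2.
by rewrite -surjective_pairing permKV.
Qed.

Lemma alternating_reverse : alternating_code D -> alternating_code reverse_code.
Proof.
by move=> alt p /=; rewrite -{2}[p](permKV (next_passage D)) alt negbK.
Qed.

Hypotheses (alt : alternating_code D) (conn : connected_diagram D).
Hypothesis planar : planar_diagram D.

Lemma int_semi_active_reverse r (T : {set crossing D}) e :
    spanning_tree T -> r \in vertices D -> e \in T ->
  int_semi_active (D := reverse_code) (reverse_region r) T e
  = ~~ int_semi_active r T e.
Proof.
move=> st rV eT; rewrite -int_semi_passive // -linked_reverse.
by rewrite /int_semi_active; case: (reverse_ends e) => ->.
Qed.

(** The left face of the reversed edge is the former right face, and [q] is joined to exactly one of
    the two across the dual bridge [e]. *)
Lemma ext_semi_active_reverse q (T : {set crossing D}) e :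
    spanning_tree T -> q \in faces D -> e \notin T ->
  ext_semi_active (D := reverse_code) (reverse_region q) T e
  = ~~ ext_semi_active q T e.
Proof.
move=> st qF eT; rewrite !ext_semi_activeE //; last first.
- rewrite [faces _](@gvertices_map _ _ _ (@left_face D) (@right_face D) _ _
    reverse_region).
    exact: imset_f.
  by move=> c; case: (reverse_ends c); right.
- exact/spanning_tree_reverse.
- exact: planar_reverse.
- exact: connected_reverse.
- exact: alternating_reverse.
have setE : ~: (e |: T) = ~: T :\ e by rewrite setCU setIC -setDE.
case: (reverse_ends e) => _ _ -> _; rewrite dual_linked_reverse setE.
apply: glinked_bridge.
- exact: dual_bridges.
- by rewrite inE.
by case/spanning_treeP: st => _ br; apply: dual_connected br _ _ _ _ => //;
  apply: left_faces.
Qed.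

End Reverse.

(** * Crossing switches and plane duality *)

Section Mirror.
Variable D : gauss_code.

Lemma swap_passage_inj : injective (fun p : crossing D * bool => (p.1, ~~ p.2)).
Proof. by move=> [c o] [c' o'] /= [-> /negb_inj ->]. Qed.

Definition swap_passage : {perm crossing D * bool} := perm swap_passage_inj.

(** The strands stay the same and only the over and under labels change, hence the conjugation. *)
Definition mirror_code : gauss_code :=
  @GaussCode (crossing D) (next_passage D ^ swap_passage)%g
    (fun c => ~~ positive c).

Lemma next_mirror (p : crossing D * bool) :
  next_passage mirror_code (p.1, ~~ p.2)
  = ((next_passage D p).1, ~~ (next_passage D p).2).
Proof. by have := permJ (next_passage D) swap_passage p; rewrite !permE. Qed.

Lemma prev_mirror (p : crossing D * bool) :
  (next_passage mirror_code)^-1%g (p.1, ~~ p.2)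
  = (((next_passage D)^-1%g p).1, ~~ ((next_passage D)^-1%g p).2).
Proof.
by have := permJ (next_passage D)^-1%g swap_passage p;
  rewrite conjVg !(permE swap_passage_inj).
Qed.

Definition mirror_dart (d : dart D) : dart mirror_code :=
  (d.1.1, ~~ d.1.2, d.2).

Lemma mirror_dart_bij : bijective mirror_dart.
Proof. by exists mirror_dart => -[[c o] b]; rewrite /mirror_dart /= negbK. Qed.

Lemma mirror_dart_step d : step (mirror_dart d) = mirror_dart (step d).
Proof.
case: d => p b; rewrite /step /mirror_dart.
case: b; rewrite /arc ?next_mirror ?prev_mirror.
  by case: (next_passage D p) => c o /=; case: o; case: (positive c).
by case: ((next_passage D)^-1%g p) => c o /=; case: o; case: (positive c).
Qed.

Definition mirror_region (u : {set dart D}) : {set dart mirror_code} :=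
  mirror_dart @: u.

Lemma mirror_region_inj : injective mirror_region.
Proof. exact/imset_inj/bij_inj/mirror_dart_bij. Qed.

Lemma region_mirror d : region (mirror_dart d) = mirror_region (region d).
Proof. exact: region_map mirror_dart_bij mirror_dart_step d. Qed.

(* Switching a crossing turns the edge through it into its dual edge. *)
Lemma mirror_ends (c : crossing D) :
  let h := mirror_region in
  if positive c then
    [/\ tail_vertex (D := mirror_code) c = h (right_face c),
        head_vertex (D := mirror_code) c = h (left_face c),
        left_face (D := mirror_code) c = h (tail_vertex c)
      & right_face (D := mirror_code) c = h (head_vertex c)]
  else
    [/\ tail_vertex (D := mirror_code) c = h (left_face c),
        head_vertex (D := mirror_code) c = h (right_face c),
        left_face (D := mirror_code) c = h (head_vertex c)
      & right_face (D := mirror_code) c = h (tail_vertex c)].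
Proof.
rewrite /= /left_face /right_face /tail_vertex /head_vertex -!region_mirror.
by rewrite /mirror_dart /=; case: (positive c).
Qed.

Lemma mirror_edge (c : crossing D) (h := mirror_region) :
  (tail_vertex (D := mirror_code) c = h (left_face c) /\
   head_vertex (D := mirror_code) c = h (right_face c)) \/
  (tail_vertex (D := mirror_code) c = h (right_face c) /\
   head_vertex (D := mirror_code) c = h (left_face c)).
Proof. by have /= := mirror_ends c; case: ifP => _ []; [right|left]. Qed.

Lemma mirror_dual_edge (c : crossing D) (h := mirror_region) :
  (left_face (D := mirror_code) c = h (tail_vertex c) /\
   right_face (D := mirror_code) c = h (head_vertex c)) \/
  (left_face (D := mirror_code) c = h (head_vertex c) /\
   right_face (D := mirror_code) c = h (tail_vertex c)).
Proof. by have /= := mirror_ends c; case: ifP => _ []; [left|right]. Qed.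

Lemma linked_mirror (S : {set crossing D}) u v :
  linked (D := mirror_code) S (mirror_region u) (mirror_region v) =
  dual_linked S u v.
Proof. exact: (glinked_map mirror_region_inj mirror_edge). Qed.

Lemma dual_linked_mirror (S : {set crossing D}) u v :
  dual_linked (D := mirror_code) S (mirror_region u) (mirror_region v) =
  linked S u v.
Proof. exact: (glinked_map mirror_region_inj mirror_dual_edge). Qed.

Lemma adjacent_pair_mirror (r q : {set dart D}) : adjacent_pair r q ->
  adjacent_pair (mirror_region q) (mirror_region r).
Proof.
move=> [c /andP[rc qc]]; exists c; have /= := mirror_ends c.
case: ifP => _ [-> -> -> ->]; rewrite !(inj_eq mirror_region_inj).
  by rewrite orbC qc rc.
by rewrite qc orbC rc.
Qed.

Lemma planar_mirror : planar_diagram D -> planar_diagram mirror_code.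
Proof.
rewrite /planar_diagram => <-.
exact: card_regions_map mirror_dart_bij mirror_dart_step.
Qed.

Lemma connected_mirror : connected_diagram D -> connected_diagram mirror_code.
Proof.
move=> conn c c'; have := conn c c'.
congr is_true; apply: eq_connect => x y /=.
apply/existsP/existsP => -[o /eqP <-]; exists (~~ o).
  by rewrite (next_mirror (x, o)).
by rewrite -[o]negbK (next_mirror (x, ~~ o)) negbK.
Qed.

Lemma alternating_mirror : alternating_code D -> alternating_code mirror_code.
Proof.
by move=> alt [c o]; rewrite -[o]negbK (next_mirror (c, ~~ o)) /= alt.
Qed.

End Mirror.

(** The complement is connected because [T] is acyclic, by the flow argument, and acyclic by the
    edge count. *)
Lemma dual_spanning_tree D T : alternating_code D -> connected_diagram D ->
    planar_diagram D -> spanning_tree T ->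
  gspanning (@left_face D) (@right_face D) (~: T).
Proof.
move=> alt conn planar st; split; last exact: dual_bridges.
by case/spanning_treeP: st => _ br; apply: dual_connected.
Qed.

(** One direction is the duality in [D]; the other is the duality in the mirrored diagram, whose
    dual edges are the original Tait edges up to direction. *)
Lemma spanning_tree_mirror D (T : {set crossing D}) :
    alternating_code D -> connected_diagram D -> planar_diagram D ->
  spanning_tree (D := mirror_code D) (~: T) <-> spanning_tree T.
Proof.
move=> alt conn planar.
have h_inj := @mirror_region_inj D; split=> [|st].
  move/(dual_spanning_tree (alternating_mirror alt) (connected_mirror conn)
    (planar_mirror planar)).
  rewrite setCK => gs; apply/spanning_treeP.
  exact: (gspanning_map h_inj (@mirror_dual_edge D) T).1 gs.
apply/spanning_treeP/(gspanning_map h_inj (@mirror_edge D)).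
exact: dual_spanning_tree.
Qed.

(** At a negative crossing the mirrored edge starts at the former left face, so both sides express
    the criterion of [ext_semi_activeE]. *)
Lemma int_semi_active_mirror D q (T : {set crossing D}) e :
    alternating_code D -> connected_diagram D -> planar_diagram D ->
    spanning_tree T -> q \in faces D -> e \notin T -> ~~ positive e ->
  int_semi_active (D := mirror_code D) (mirror_region q) (~: T) e =
    ext_semi_active q T e.
Proof.
move=> alt conn planar st qF eT /negbTE eN; rewrite ext_semi_activeE //.
rewrite /int_semi_active; have := mirror_ends e; rewrite eN => -[-> _ _ _].
by rewrite linked_mirror setCU setIC -setDE.
Qed.

(** At a positive crossing the left face of the mirrored edge is the former tail; the criterion is
    applied in the mirrored diagram. *)
Lemma ext_semi_active_mirror D r (T : {set crossing D}) e :
    alternating_code D -> connected_diagram D -> planar_diagram D ->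
    spanning_tree T -> r \in vertices D -> e \in T -> positive e ->
  ext_semi_active (D := mirror_code D) (mirror_region r) (~: T) e =
    int_semi_active r T e.
Proof.
move=> alt conn planar st rV eT eP; rewrite ext_semi_activeE.
- have := mirror_ends e; rewrite eP => -[_ _ -> _].
  by rewrite dual_linked_mirror setCU setCK setIC -setDE.
- exact: alternating_mirror.
- exact: connected_mirror.
- exact: planar_mirror.
- exact/spanning_tree_mirror.
- rewrite [faces _](gvertices_map (@mirror_dual_edge D)).
  exact: imset_f.
- by rewrite inE eT.
Qed.

(** * Comparison of the tree sums *)

Lemma peval_tait D (F : fieldType) r q (x y z w : F) :
  peval (tait_polynomial (D := D) r q) x y z w =
  \sum_(T : {set crossing D} | `[< spanning_tree T >])
    x^-1 ^+ iota_pos r T * y^-1 ^+ iotabar_pos r T *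
    z ^+ eps_neg q T * w ^+ epsbar_neg q T.
Proof.
rewrite /peval /tait_polynomial (raddf_sum (mmap (intmul 1 : int -> F) _)).
apply: eq_bigr => T _; rewrite [LHS](mmapX _ (intmul 1 : {rmorphism int -> F})).
rewrite /mmap1 !big_ord_recl big_ord0 mulr1 /=.
by rewrite !mulrA.
Qed.

Lemma tait_reverse D (F : fieldType) r q (x y z w : F) :
    alternating_code D -> connected_diagram D -> planar_diagram D ->
    adjacent_pair (D := D) r q ->
  peval (tait_polynomial (reverse_region r) (reverse_region q)) y x w z =
  peval (tait_polynomial r q) x y z w.
Proof.
move=> alt conn planar /adjacent_pair_mem[rV qF]; rewrite !peval_tait.
apply: eq_big => T; first by apply/asboolP/asboolP => /spanning_tree_reverse.
move=> /asboolP/spanning_tree_reverse st.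
(* The factors in [x] and [y], and those in [z] and [w], trade places to match the exchanged
   activities. *)
rewrite [in RHS](mulrC (x^-1 ^+ _)) -![in RHS]mulrA [in RHS](mulrC (z ^+ _))
  !mulrA.
congr (_ ^+ _ * _ ^+ _ * _ ^+ _ * _ ^+ _); apply: eq_card => e; rewrite !inE.
- case eT: (e \in T) => //=; congr (_ && _); exact: int_semi_active_reverse.
- case eT: (e \in T) => //=; congr (_ && _).
  by rewrite int_semi_active_reverse ?negbK.
- case eT: (e \in T) => //=; congr (_ && _).
  by apply: ext_semi_active_reverse; rewrite ?eT.
- case eT: (e \in T) => //=; congr (_ && _).
  by rewrite ext_semi_active_reverse ?eT ?negbK.
Qed.

Lemma tait_mirror D (F : fieldType) r q (x y z w : F) :
    alternating_code D -> connected_diagram D -> planar_diagram D ->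
    adjacent_pair (D := D) r q ->
  peval (tait_polynomial (mirror_region q) (mirror_region r))
    z^-1 w^-1 x^-1 y^-1 =
  peval (tait_polynomial r q) x y z w.
Proof.
move=> alt conn planar /adjacent_pair_mem[rV qF]; rewrite !peval_tait.
(* Trees of the mirrored diagram are indexed by their complements. *)
rewrite (reindex_inj (can_inj (@setCK _))) /= !invrK.
apply: eq_big => T.
  by apply/asboolP/asboolP => /spanning_tree_mirror; apply.
move=> /asboolP/spanning_tree_mirror st; have {}st := st alt conn planar.
(* Internal and external factors trade places. *)
rewrite -[LHS]mulrA [LHS]mulrC mulrA.
congr (_ ^+ _ * _ ^+ _ * _ ^+ _ * _ ^+ _); apply: eq_card => e;
  rewrite !inE /= ?negbK;
  case eT: (e \in T) => //=; case eP: (@positive D e) => //=.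
- exact: ext_semi_active_mirror.
- by rewrite ext_semi_active_mirror.
- by apply: int_semi_active_mirror; rewrite ?eT ?eP.
- by rewrite int_semi_active_mirror ?eT ?eP.
Qed.

(** * Isotopies and projections *)

From mathcomp Require Import all_classical all_reals all_analysis.
Import numFieldNormedType.Exports.
Local Open Scope classical_set_scope.
Local Open Scope ring_scope.

(** Isotopies are only continuous within the time interval, so they are composed between
    subspaces. *)
Lemma continuous_subspace_comp (S T U : topologicalType) (A : set S) (B : set T)
    (f : S -> T) (g : T -> U) :
  {within A, continuous f} -> (forall x, A x -> B (f x)) ->
  {within B, continuous g} -> {within A, continuous (g \o f)}.
Proof.
move=> /subspace_continuousP cf AB /subspace_continuousP cg.
apply/subspace_continuousP => x Ax.
apply: (@cvg_trans _ (g @ within B (nbhs (f x)))); last exact/cg/AB.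
apply: (@cvg_fmap2 _ _ g (within B (nbhs (f x))) (f @ within A (nbhs x))) => W
  /(cf x Ax) /=.
by apply: (@filterS _ (nbhs x)) => y H Ay; apply: (H Ay); apply: AB.
Qed.

Section Isotopy.
Variable R : realType.
Implicit Types (K L N : link R) (D : gauss_code).

(** Both isotopies run simultaneously, which avoids gluing them in time. *)
Lemma ambient_isotopy_comp (H1 H2 : R -> 'rV[R]_3 -> 'rV[R]_3) :
  ambient_isotopy H1 -> ambient_isotopy H2 ->
  ambient_isotopy (fun t v => H2 t (H1 t v)).
Proof.
move=> [c1 s1 g1] [c2 s2 g2]; split; last 1 first.
- move=> t t01; have [G1 [cH1 cG1 HG1 GH1]] := g1 t t01.
  have [G2 [cH2 cG2 HG2 GH2]] := g2 t t01; exists (G1 \o G2); split.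
  + move=> v; apply: (@continuous_comp _ _ _ (H1 t) (H2 t));
      [exact: cH1|exact: cH2].
  + move=> v; apply: (@continuous_comp _ _ _ G2 G1); [exact: cG2|exact: cG1].
  + by move=> v; rewrite /= HG2 HG1.
  + by move=> v; rewrite /= GH1 GH2.
- pose h p := (p.1, H1 p.1 p.2).
  apply: (@continuous_subspace_comp _ _ _ _ _ h) c2 => //.
  apply/subspace_continuousP => p p01.
  have c1p : (fun p => H1 p.1 p.2) @ within [set p | 0 <= p.1 <= 1] (nbhs p)
      --> H1 p.1 p.2 by move/subspace_continuousP: c1; apply.
  have fstp : fst @ within [set p : R * 'rV[R]_3 | 0 <= p.1 <= 1] (nbhs p)
      --> p.1.
    by apply: cvg_within_filter; exact: cvg_fst.
  exact: cvg_pair fstp c1p.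
- by move=> v; rewrite s1 s2.
Qed.

(** Conjugating by an involution keeps the identity at time 0. *)
Lemma ambient_isotopy_conj (H : R -> 'rV[R]_3 -> 'rV[R]_3) :
  ambient_isotopy H ->
  ambient_isotopy (fun t v => reflect3 (H t (reflect3 v))).
Proof.
move=> [c1 s1 g1]; split; last 1 first.
- move=> t t01; have [G [cH cG HG GH]] := g1 t t01.
  exists (fun v => reflect3 (G (reflect3 v))); split.
  + move=> v; apply: (@continuous_comp _ _ _ _ (@reflect3 R));
      last exact: reflect3_continuous.
    apply: (@continuous_comp _ _ _ (@reflect3 R) (H t));
      [exact: reflect3_continuous|exact: cH].
  + move=> v; apply: (@continuous_comp _ _ _ _ (@reflect3 R));
      last exact: reflect3_continuous.
    apply: (@continuous_comp _ _ _ (@reflect3 R) G);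
      [exact: reflect3_continuous|exact: cG].
  + by move=> v; rewrite reflect3K HG reflect3K.
  + by move=> v; rewrite reflect3K GH reflect3K.
- have c3 : {within [set p : R * 'rV[R]_3 | 0 <= p.1 <= 1],
      continuous (fun p => H p.1 (reflect3 p.2))}.
    apply: (@continuous_subspace_comp _ _ _ _ _ (fun p => (p.1, reflect3 p.2)))
      c1 => //.
    apply: continuous_subspaceT => p.
    have fstp : fst @ nbhs p --> p.1 by apply: cvg_fst.
    have sndp : (@reflect3 R \o snd) @ nbhs p --> reflect3 p.2.
      by apply: continuous_comp; [apply: cvg_snd|apply: reflect3_continuous].
    exact: cvg_pair fstp sndp.
  apply: within_continuous_comp c3 => v _; exact: reflect3_continuous.
- by move=> v; rewrite s1 reflect3K.
Qed.

Lemma isotopic_trans K L N : isotopic K L -> isotopic L N -> isotopic K N.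
Proof.
move=> [H1 [s1 [p1 [i1 b1 c1 E1]]]] [H2 [s2 [p2 [i2 b2 c2 E2]]]].
exists (fun t v => H2 t (H1 t v)), (s2 \o s1), (fun i t => p2 (s1 i) (p1 i t)).
split; [exact: ambient_isotopy_comp|exact: bij_comp| |].
- move=> i; have [cp1 m1 t1] := c1 i; have [cp2 m2 t2] := c2 (s1 i); split.
  + move=> t; apply: (@continuous_comp _ _ _ (p1 i) (p2 (s1 i)));
      [exact: cp1|exact: cp2].
  + by move=> s t /m1 /m2.
  + by move=> t; rewrite t1 t2.
- by move=> i t; rewrite /= E2 E1.
Qed.

Lemma isotopic_reverse K L : isotopic K L -> isotopic (reverse K) (reverse L).
Proof.
(* Conjugating the reparametrization by negation keeps it increasing and compatible with the
   period. *)
move=> [H [s [p [i b c E]]]]; exists H, s, (fun i t => - p i (- t)); split=> //.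
- move=> j; have [cp m pS] := c j; split.
  + move=> x.
    apply: (@continuous_comp _ _ _ (fun x => p j (- x)) (fun x : R => - x));
      last exact: opp_continuous.
    apply: (@continuous_comp _ _ _ (fun x : R => - x) (p j)); last exact: cp.
    exact: opp_continuous.
  + by move=> x y xy; rewrite ltrN2; apply: m; rewrite ltrN2.
  + move=> x; have := pS (- (x + 1)); rewrite opprD addrNK => ->.
    by rewrite opprD addrNK.
- by move=> j t /=; rewrite opprK E.
Qed.

Lemma isotopic_mirror K L : isotopic K L -> isotopic (mirror K) (mirror L).
Proof.
move=> [H [s [p [i b c E]]]].
exists (fun t v => reflect3 (H t (reflect3 v))), s, p; split=> //.
  exact: ambient_isotopy_conj.
by move=> j t /=; rewrite reflect3K E.
Qed.

(** * Projections of reversed and mirrored links *)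

Lemma strand_intr K i t (n : int) : strand K i (t + n%:~R) = strand K i t.
Proof.
have nat_case x (m : nat) : strand K i (x + m%:R) = strand K i x.
  by elim: m => [|m IH]; rewrite ?addr0 // -natr1 addrA strand_periodic.
case: n => m; first exact: nat_case.
by rewrite NegzE -[in RHS](subrK m.+1%:R t) nat_case mulrNz.
Qed.

Lemma derive1_opp (f : R -> R) t : derivable f t 1 ->
  derivable (fun s => f (- s)) (- t) 1 /\
  derive1 (fun s => f (- s)) (- t) = - derive1 f t.
Proof.
move=> /derivableP df.
have [d e] : is_derive (- t) 1 (f \o -%R) ('D_1 f t * -1).
  by apply: is_derive1_comp; rewrite opprK.
by split=> //; rewrite !derive1E e mulrN1.
Qed.

(** Passage times are negated; both velocities at a crossing change sign, which leaves [det2]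
    unchanged. *)
Lemma projects_to_reverse L D :
  projects_to L D -> projects_to (reverse L) (reverse_code D).
Proof.
move=> [comp [time [[inj onto] over double next cross]]].
exists comp, (fun p => - time p); rewrite /=; split.
- by split=> // p p'; rewrite !opprK; apply: inj.
- by move=> c; rewrite !opprK; apply: over.
- move=> u v [i [s us]] [j [t vt]] uv.
  have su : support L u by exists i, (- s).
  have sv : support L v by exists j, (- t).
  have [uE | [c [b [uE vE]]]] := double u v su sv uv; first by left.
  by right; exists c, b; rewrite !opprK.
- move=> p; have [t [tp]] := next ((next_passage D)^-1%g p).
  rewrite permKV => st min; have [cE [n tE]] := strand_inj st.
  set q := (next_passage D)^-1%g p in tp st min cE *.
  (* In [L] the strand goes from [q] at [time q] to [p] at [t = time p + n]. Negating these times
     and adding [n] makes the reversed strand start at [- time p]. *)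
  exists (n%:~R - time q); split.
  + by rewrite tE in tp; lra.
  + by rewrite opprB opprK -cE -(strand_intr _ (time q - n%:~R) n) subrK.
  + move=> s p' /andP[s1 s2]; rewrite opprK -(strand_intr _ (- s) n) -cE.
    by apply: min; rewrite tE; apply/andP; split; lra.
- move=> c; have [vd d0 pE] := cross c.
  have vE o : velocity (L := reverse L) (comp (c, o)) (- time (c, o)) =
      (- (velocity (L := L) (comp (c, o)) (time (c, o))).1,
       - (velocity (L := L) (comp (c, o)) (time (c, o))).2).
    by have [/derive1_opp[_ e0] /derive1_opp[_ e1]] := vd o;
      rewrite /velocity /= e0 e1.
  have dE :
      det2 (velocity (L := reverse L) (comp (c, true)) (- time (c, true)))
           (velocity (L := reverse L) (comp (c, false)) (- time (c, false))) =
      det2 (velocity (L := L) (comp (c, true)) (time (c, true)))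
           (velocity (L := L) (comp (c, false)) (time (c, false))).
    by rewrite !vE /det2 /= !mulrNN.
  rewrite dE; split=> // o; have [v0 v1] := vd o.
  by split; [case: (derive1_opp v0)|case: (derive1_opp v1)].
Qed.

Lemma reflect3E (v : 'rV[R]_3) j :
  reflect3 v 0 j = if j == 2 then - v 0 2 else v 0 j.
Proof.
rewrite /reflect3 !mxE eqxx /=; have [->|_] := eqVneq j 2.
  by rewrite mulr1; ring.
by rewrite mulr0 subr0.
Qed.

Lemma reflect3_xy (v : 'rV[R]_3) : xy (reflect3 v) = xy v.
Proof. by rewrite /xy !reflect3E. Qed.

Lemma reflect3_height (v : 'rV[R]_3) : height (reflect3 v) = - height v.
Proof. by rewrite /height reflect3E. Qed.

Lemma velocity_mirror L i t :
  (velocity_defined (L := mirror L) i t = velocity_defined (L := L) i t) /\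
  velocity (L := mirror L) i t = velocity (L := L) i t.
Proof.
have E0 : (fun s => strand (mirror L) i s 0 0) = (fun s => strand L i s 0 0).
  by apply/funext => s; have [] := reflect3_xy (strand L i s).
have E1 : (fun s => strand (mirror L) i s 0 1) = (fun s => strand L i s 0 1).
  by apply/funext => s; have [] := reflect3_xy (strand L i s).
by rewrite /velocity_defined /velocity E0 E1.
Qed.

(** The projection is unchanged while heights are negated, so [swap] renames the passages and
    exchanges the arguments of [det2]. *)
Lemma projects_to_mirror L D :
  projects_to L D -> projects_to (mirror L) (mirror_code D).
Proof.
move=> [comp [time [[inj onto] over double next cross]]].
pose swap (p : crossing D * bool) := (p.1, ~~ p.2).
have swapK : involutive swap by move=> [c o]; rewrite /swap /= negbK.
exists (comp \o swap), (time \o swap); rewrite /=; split.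
- split; last first.
    by move=> i; have [p <-] := onto i; exists (swap p); rewrite /= swapK.
  by move=> p p' /(can_inj (@reflect3K R)) /inj /(can_inj swapK).
- move=> c; have [xyE hlt] := over c; rewrite /swap !reflect3_xy
    !reflect3_height /=.
  by rewrite ltrN2.
- move=> u v [i [s us]] [j [t vt]] uv.
  have := double (reflect3 u) (reflect3 v); rewrite !reflect3_xy => /(_ _ _ uv)
    [||uE | [c [b [uE vE]]]].
  + by exists i, s; rewrite -us /= reflect3K.
  + by exists j, t; rewrite -vt /= reflect3K.
  + by left; apply: can_inj (@reflect3K R) _ _ uE.
  right; exists c, (~~ b); rewrite /swap /= negbK -uE -vE !reflect3K.
  by split.
- move=> p; have [t [tp [st min]]] := next (swap p); exists t; split=> //.
    have -> : swap ((next_passage D ^ swap_passage D)%g p) =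
        next_passage D (swap p).
      by rewrite -{1}[p]swapK (next_mirror (swap p)); apply: swapK.
    by rewrite st.
  by move=> s p' /min sp' /(can_inj (@reflect3K R)); apply: sp'.
- move=> c; have [vd d0 pE] := cross c; rewrite /swap /=.
  have vE i t := (velocity_mirror i t).2.
  rewrite !vE; set d := det2 _ _.
  have dE : d = - det2 (velocity (L := L) (comp (c, true)) (time (c, true)))
                 (velocity (L := L) (comp (c, false)) (time (c, false))).
    by rewrite /d /det2; ring.
  split; last 2 first.
  + by rewrite dE oppr_eq0.
  (* Transversality makes the negation of [0 < det2] a strict inequality. *)
  + by rewrite dE pE oppr_gt0 -leNgt le_eqVlt (negbTE d0).
  by move=> o; rewrite (velocity_mirror _ _).1.
Qed.

(** [K] is isotopic to [reverse K], hence to [reverse L] for the link [L] that projects to [D]. *)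
Lemma diagram_of_reverse D K :
  diagram_of D K -> invertible K -> diagram_of (reverse_code D) K.
Proof.
move=> [conn planar [L KL LD]] inv; split.
- exact: connected_reverse.
- exact: planar_reverse.
exists (reverse L); last exact: projects_to_reverse.
exact: isotopic_trans inv (isotopic_reverse KL).
Qed.

Lemma diagram_of_mirror D K :
  diagram_of D K -> amphichiral K -> diagram_of (mirror_code D) K.
Proof.
move=> [conn planar [L KL LD]] inv; split.
- exact: connected_mirror.
- exact: planar_mirror.
exists (mirror L); last exact: projects_to_mirror.
exact: isotopic_trans inv (isotopic_mirror KL).
Qed.

(** A link has a component [ord0], which meets a crossing; the tail and the left face of that Tait
    edge are adjacent. *)
Lemma adjacent_pair_exists D K : diagram_of D K ->
  exists r q, adjacent_pair (D := D) r q.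
Proof.
move=> [_ _ [L _ [comp [_ [[_ onto] _ _ _ _]]]]]; have [[c b] _] := onto ord0.
by exists (tail_vertex c), (left_face c), c; rewrite !eqxx.
Qed.

(* This makes the invariance of the tree sums unnecessary: if it failed, then
   link_polynomial would be the default value 0 and the identities trivial. *)
Lemma link_polynomial_dichotomy K :
  is_link_polynomial K (link_polynomial K) \/ link_polynomial K = 0.
Proof.
rewrite /link_polynomial.
have [[P HP]|nP] := pselect (exists P, is_link_polynomial K P).
  by left; apply: xgetI HP.
by right; apply: xgetPN => P HP; apply: nP; exists P.
Qed.

Lemma peval0 (F : fieldType) (x y z w : F) : peval 0 x y z w = 0.
Proof. exact: (raddf0 (mmap (intmul 1 : int -> F) _)). Qed.

End Isotopy.

Theorem corollary4p8 (R : realType) (K : link R)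
    (K_nonsplit : ~ split_link K) (K_alternating : alternating_link K) :
  let x := ratvar 0 in let y := ratvar 1 in
  let z := ratvar 2 in let w := ratvar 3 in
  (invertible K -> P_ K x y z w = P_ K y x w z) /\
  (amphichiral K -> P_ K x y z w = P_ K z^-1 w^-1 x^-1 y^-1).
Proof.
move=> x y z w; rewrite /P_.
have [[_ PK]|->] := link_polynomial_dichotomy K; last by rewrite !peval0.
have [D DK alt] := K_alternating; have [r [q rq]] := adjacent_pair_exists DK.
have [conn planar _] := DK; split=> sym; rewrite -[in LHS](PK D r q) //.
  rewrite -(PK (reverse_code D) (reverse_region r) (reverse_region q)).
  - by rewrite tait_reverse.
  - exact: diagram_of_reverse.
  - exact: alternating_reverse.
  - exact: adjacent_pair_reverse.
(* Under duality the face [q] becomes the root and [r] the base face. *)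
rewrite -(PK (mirror_code D) (mirror_region q) (mirror_region r)).
- by rewrite tait_mirror.
- exact: diagram_of_mirror.
- exact: alternating_mirror.
- exact: adjacent_pair_mirror.
Qed.
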